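(* Let $f:\{0,1\}^n\to\{0,1\}$ be a non-constant monotone Boolean function. Then \[ \mathrm{Arith}\big(\mathrm{Env}(\mathrm{Low}(f))\big)\leq \mathrm{Read}_1(f)\leq \mathrm{Lin}(f)=\mathrm{mLin}(f)\leq \mathrm{Arith}(\mathrm{Low}(f)). \] In particular, if $f$ is also homogeneous, then $\mathrm{Arith}(\mathrm{Low}(f))=\mathrm{Read}_1(f)=\mathrm{Lin}(f)=\mathrm{mLin}(f)$.
   Context: For monotone $f$, $\mathrm{Low}(f)$ is the set of $a\in\{0,1\}^n$ with $f(a)=1$ and $f(b)=0$ for all $b\leq a$, $b\neq a$; $f$ is homogeneous if all vectors of $\mathrm{Low}(f)$ have the same number of ones. A monotone Boolean circuit is a directed acyclic graph (parallel edges allowed) whose indegree-zero nodes hold variables among $x_1,\dots,x_n$ (no constants) and whose gates have indegree two and are labeled $\lor$ or $\land$; size = number of gates. The set $B_F\subseteq\mathbb{N}^n$ of exponent vectors produced by $F$: $B_{x_i}=\{e_i\}$, $B_{G\lor H}=B_G\cup B_H$, $B_{G\land H}=\{b+c:b\in B_G,c\in B_H\}$. A monotone circuit computing $f$ is read-$1$ if $\mathrm{Low}(f)\subseteq B_F$; $\mathrm{Read}_1(f)$ is the minimum size of such a circuit. A DeMorgan circuit is a $(\lor,\land)$ circuit whose inputs are the literals $x_1,\dots,x_n,\bar x_1,\dots,\bar x_n$. A Boolean function depends on $x_i$ if its value changes for some pair of inputs differing only in position $i$; two functions are independent if they depend on disjoint sets of variables. A (DeMorgan or monotone) circuit is multilinear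 if the two functions computed at the inputs of every AND gate are independent. $\mathrm{Lin}(f)$ is the minimum size of a multilinear DeMorgan circuit computing $f$; $\mathrm{mLin}(f)$ is the minimum size of a monotone multilinear circuit computing $f$. For finite $A\subseteq\mathbb{N}^n$, $\mathrm{Arith}(A)$ is the minimum size of a monotone arithmetic $(+,\times)$ circuit with only variables as inputs producing (as formal expansion, no cancellations) a polynomial $\sum_{a\in A}c_a\prod_ix_i^{a_i}$ with integers $c_a\geq1$. $\mathrm{Env}(A)$ is the set of vectors $a\in A$ of minimum degree $a_1+\dots+a_n$. *)

(* Defs.v *)
From mathcomp Require Import all_boot all_order all_algebra.
From mathcomp Require Import finmap.
From mathcomp Require Import mpoly.

Set Implicit Arguments.
Unset Strict Implicit.
Unset Printing Implicit Defensive.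

Local Open Scope nat_scope.

(** * Boolean functions *)

Notation bvec n := {ffun 'I_n -> bool}.

Section BooleanFunctions.
Variable n : nat.
Implicit Types (f g h : bvec n -> bool) (a b : bvec n).

Definition bvle a b : bool := [forall i, a i ==> b i].

Definition bweight a : nat := #|[set i | a i]|.

Definition monotone_fun f : Prop := forall a b, bvle a b -> f a ==> f b.

Definition non_constant f : Prop := ~ exists c, forall a, f a = c.

Definition Low f : {set bvec n} :=
  [set a | f a && [forall b, bvle b a && (b != a) ==> ~~ f b]].

Definition homogeneous f : Prop :=
  {in Low f &, forall a b, bweight a = bweight b}.

(* The inner test says that a and b differ in position i and nowhere else. *)
Definition depends_on g (i : 'I_n) : Prop :=
  exists a b : bvec n, (forall j, (a j != b j) = (j == i)) /\ g a <> g b.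

Definition independent g h : Prop :=
  forall i, ~ (depends_on g i /\ depends_on h i).

End BooleanFunctions.

(** * Exponent vectors *)

Section ExponentVectors.
Variable n : nat.

Definition mnm_of_bvec (a : bvec n) : 'X_{1..n} :=
  [multinom nat_of_bool (a i) | i < n].

Definition LowN (f : bvec n -> bool) : {fset 'X_{1..n}} :=
  [fset mnm_of_bvec a | a in Low f]%fset.

Definition Env (A : {fset 'X_{1..n}}) : {fset 'X_{1..n}} :=
  [fset a in A | [forall b : A, mdeg a <= mdeg (val b)]]%fset.

End ExponentVectors.

(** * Circuits *)

(* A fanin-two circuit with input labels in I is a directed acyclic graph given
   in a topological order of its gates: the two wires of the gate number k come
   from input nodes or from gates numbered below k, and may coincide.  The same
   syntax serves Boolean circuits (Sum is OR, Prod is AND) and arithmetic ones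
   (Sum is addition, Prod is multiplication).  Input nodes are free, so only
   gates are listed. *)

Variant gate_op := Sum | Prod.

Variant node (I : Type) := Input of I | Gate of nat.

Record gate (I : Type) := MkGate {
  op : gate_op;
  left_in : node I;
  right_in : node I
}.

Definition node_below I (k : nat) (u : node I) : bool :=
  if u is Gate j then j < k else true.

Fixpoint topological I (k : nat) (gs : seq (gate I)) : bool :=
  if gs is g :: gs' then
    [&& node_below k (left_in g), node_below k (right_in g)
      & topological k.+1 gs']
  else true.

Record circuit (I : Type) := Circuit {
  gates : seq (gate I);
  output : node I;
  _ : topological 0 gates && node_below (size gates) output
}.

Definition circuit_size I (F : circuit I) : nat := size (gates F).

Section Evaluation.
Variables (I V : Type) (dflt : V) (inp : I -> V) (add mul : V -> V -> V).

(* dflt is never reached at the nodes of a circuit, whose wires are in range. *)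
Definition node_val (vs : seq V) (u : node I) : V :=
  match u with Input x => inp x | Gate k => nth dflt vs k end.

Definition gate_val (vs : seq V) (g : gate I) : V :=
  (if op g is Sum then add else mul)
    (node_val vs (left_in g)) (node_val vs (right_in g)).

Definition gate_vals (gs : seq (gate I)) : seq V :=
  foldl (fun vs g => rcons vs (gate_val vs g)) [::] gs.

Definition value_at (F : circuit I) (u : node I) : V :=
  node_val (gate_vals (gates F)) u.

Definition value (F : circuit I) : V := value_at F (output F).

End Evaluation.

(* m is the minimum size of a circuit satisfying P; in particular there is
   such a circuit. *)
Definition is_min_size I (P : circuit I -> Prop) (m : nat) : Prop :=
  (exists2 F, P F & circuit_size F = m) /\
  (forall F, P F -> m <= circuit_size F).

(** * Boolean circuits *)

Section BooleanCircuits.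
Variables (n : nat) (I : Type) (inp : bvec n -> I -> bool).
Implicit Type F : circuit I.

Definition fun_at F (u : node I) : bvec n -> bool :=
  fun a => value_at false (inp a) orb andb F u.

Definition computes F (f : bvec n -> bool) : Prop :=
  forall a, fun_at F (output F) a = f a.

Definition multilinear F : Prop :=
  forall k g, onth (gates F) k = Some g -> op g = Prod ->
    independent (fun_at F (left_in g)) (fun_at F (right_in g)).

End BooleanCircuits.

Definition var_input n (a : bvec n) (i : 'I_n) : bool := a i.

(* (i, true) is the literal x_i and (i, false) is its negation. *)
Definition lit_input n (a : bvec n) (l : 'I_n * bool) : bool := a l.1 == l.2.

Notation monotone_circuit n := (circuit 'I_n).
Notation demorgan_circuit n := (circuit ('I_n * bool)).

Definition produced n (F : monotone_circuit n) : {fset 'X_{1..n}} :=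
  value fset0 (fun i => [fset U_(i)%MM])%fset
    (fun B C => B `|` C)%fset
    (fun B C => [fset (b + c)%MM | b in B, c in C])%fset F.

Definition read1 n (f : bvec n -> bool) (F : monotone_circuit n) : Prop :=
  computes (@var_input n) F f /\ (LowN f `<=` produced F)%fset.

Definition is_Read1 n (f : bvec n -> bool) (m : nat) : Prop :=
  is_min_size (read1 f) m.

Definition is_Lin n (f : bvec n -> bool) (m : nat) : Prop :=
  is_min_size (fun F : demorgan_circuit n =>
    computes (@lit_input n) F f /\ multilinear (@lit_input n) F) m.

Definition is_mLin n (f : bvec n -> bool) (m : nat) : Prop :=
  is_min_size (fun F : monotone_circuit n =>
    computes (@var_input n) F f /\ multilinear (@var_input n) F) m.

(** * Arithmetic circuits *)

Section ArithmeticCircuits.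
Import GRing.Theory Num.Theory.
Local Open Scope ring_scope.

(* The inputs being variables, no cancellation occurs in {mpoly int[n]}: this
   is the formal expansion. *)
Definition circuit_poly n (F : monotone_circuit n) : {mpoly int[n]} :=
  value 0 (fun i => 'X_i) +%R *%R F.

Definition arith_produces n (A : {fset 'X_{1..n}}) (F : monotone_circuit n) :
    Prop :=
  exists2 c : 'X_{1..n} -> int, {in A, forall a, 1 <= c a} &
    circuit_poly F = \sum_(a <- A) c a *: 'X_[a].

Definition is_Arith n (A : {fset 'X_{1..n}}) (m : nat) : Prop :=
  is_min_size (arith_produces A) m.

End ArithmeticCircuits.

(* Main.v *)
Require Import Defs.
From mathcomp Require Import all_boot all_order all_algebra.
From mathcomp Require Import finmap.
From mathcomp Require Import mpoly.
From Stdlib Require Import Classical FunctionalExtensionality.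

Set Implicit Arguments.
Unset Strict Implicit.
Unset Printing Implicit Defensive.

Local Open Scope nat_scope.

(* Every monotone circuit is evaluated in the algebra of finite sets of exponent
   vectors.  Since a monotone arithmetic circuit has no cancellations, the support of its
   polynomial is its produced set, and the Boolean function computed at a node
   is the set of points lying above the support of some produced vector.  Each
   inequality then comes from a gate-by-gate simulation that never adds gates:
   - keeping only the terms of smallest degree turns a read-1 circuit into an
     arithmetic circuit for Env (Low f);
   - in a multilinear monotone circuit every gate g satisfies Low g <= B_g,
     because minimal ones of independent functions have disjoint supports;
   - setting all negated inputs of a multilinear DeMorgan circuit to 1 replaces
     the function at each gate by its upward closure;
   - in a circuit for the multilinear set Low f, the factors of a product that
     contributes to the output have disjoint variables. *)

(** * Evaluation of gate lists in an arbitrary algebra *)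

Lemma onth_rcons T (s : seq T) x k :
  onth (rcons s x) k =
    if k < size s then onth s k else if k == size s then Some x else None.
Proof.
rewrite -cats1 onth_cat; case: ltnP => // le_s_k.
rewrite eqn_leq le_s_k andbT -subn_eq0.
by case: (k - size s) => [|[]].
Qed.

Section Values.
Variables (I V : Type) (dflt : V) (inp : I -> V) (add mul : V -> V -> V).
Implicit Types (gs : seq (gate I)) (g : gate I) (u : node I) (vs : seq V).

Local Notation nval := (node_val dflt inp).
Local Notation gvals := (gate_vals dflt inp add mul).

Definition op_val (o : gate_op) : V -> V -> V := if o is Sum then add else mul.

Definition list_val gs u : V := nval (gvals gs) u.

(** Wires enter only through their values, so that a semantic condition such as multilinearity can
    be carried from one algebra to another. *)
Definition gates_satisfy (T : gate_op -> V -> V -> Prop) gs : Prop :=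
  forall k g, onth gs k = Some g ->
    T (op g) (list_val gs (left_in g)) (list_val gs (right_in g)).

Lemma topological_rcons k gs g :
  topological k (rcons gs g) =
    [&& topological k gs, node_below (k + size gs) (left_in g)
      & node_below (k + size gs) (right_in g)].
Proof.
elim: gs k => [|g' gs IHgs] k /=; first by rewrite addn0 andbT.
by rewrite IHgs addSnnS -!andbA.
Qed.

Lemma node_below_leq k l u : k <= l -> node_below k u -> node_below l u.
Proof. by case: u => //= j le_kl lt_jk; apply: leq_trans le_kl. Qed.

Lemma topological_onth gs k g : topological 0 gs -> onth gs k = Some g ->
  node_below (size gs) (left_in g) && node_below (size gs) (right_in g).
Proof.
elim/last_ind: gs => [|gs g' IHgs]; first by rewrite onth0n.
rewrite topological_rcons onth_rcons add0n size_rcons => /and3P[top_gs lg rg].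
have le_gs u : node_below (size gs) u -> node_below (size gs).+1 u.
  exact: node_below_leq.
case: ltnP => _; last by case: eqP => // _ [<-]; rewrite !le_gs.
by move=> /(IHgs top_gs)/andP[? ?]; rewrite !le_gs.
Qed.

Lemma gate_vals_rcons gs g :
  gvals (rcons gs g) = rcons (gvals gs) (gate_val dflt inp add mul (gvals gs) g).
Proof. by rewrite /gate_vals foldl_rcons. Qed.

Lemma size_gate_vals gs : size (gvals gs) = size gs.
Proof.
by elim/last_ind: gs => // gs g IHgs; rewrite gate_vals_rcons !size_rcons IHgs.
Qed.

Lemma list_val_rcons gs g u :
  node_below (size gs) u -> list_val (rcons gs g) u = list_val gs u.
Proof.
rewrite /list_val gate_vals_rcons; case: u => //= k lt_k.
by rewrite nth_rcons size_gate_vals lt_k.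
Qed.

Lemma list_val_last gs g :
  list_val (rcons gs g) (Gate I (size gs)) =
    op_val (op g) (list_val gs (left_in g)) (list_val gs (right_in g)).
Proof.
by rewrite /list_val gate_vals_rcons /= nth_rcons size_gate_vals ltnn eqxx.
Qed.

(** In topological order the old gates never read the appended one, so their wires keep their
    values. *)
Lemma gates_satisfy_rcons (T : gate_op -> V -> V -> Prop) gs g :
  topological 0 (rcons gs g) ->
  gates_satisfy T (rcons gs g) <->
  gates_satisfy T gs /\
    T (op g) (list_val gs (left_in g)) (list_val gs (right_in g)).
Proof.
rewrite topological_rcons add0n => /and3P[top_gs lg rg].
have valE k g' : onth gs k = Some g' ->
    list_val (rcons gs g) (left_in g') = list_val gs (left_in g') /\
    list_val (rcons gs g) (right_in g') = list_val gs (right_in g').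
  by move=> /(topological_onth top_gs)/andP[? ?]; rewrite !list_val_rcons.
split=> [Tgs | [Tgs Tg] k g'].
  split=> [k g' gs_k|].
    have [<- <-] := valE _ _ gs_k; apply: (Tgs k).
    by rewrite onth_rcons gs_k; move: (onthTE gs k); rewrite gs_k /= => <-.
  have := Tgs (size gs) g; rewrite !list_val_rcons // onth_rcons ltnn eqxx.
  exact.
rewrite onth_rcons; case: ltnP => [_ gs_k | _].
  by have [-> ->] := valE _ _ gs_k; apply: (Tgs k).
by case: eqP => // _ [<-]; rewrite !list_val_rcons.
Qed.

End Values.

(** * Comparison and simulation of circuits over two algebras *)

Lemma list_val_rel (I V W : Type) (R : V -> W -> Prop) dflt1 dflt2 inp1 inp2
    add1 mul1 add2 mul2 (gs : seq (gate I)) u :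
  R dflt1 dflt2 -> (forall x, R (inp1 x) (inp2 x)) ->
  (forall v1 v2 w1 w2, R v1 w1 -> R v2 w2 -> R (add1 v1 v2) (add2 w1 w2)) ->
  (forall v1 v2 w1 w2, R v1 w1 -> R v2 w2 -> R (mul1 v1 v2) (mul2 w1 w2)) ->
  R (list_val dflt1 inp1 add1 mul1 gs u) (list_val dflt2 inp2 add2 mul2 gs u).
Proof.
move=> Rd Ri Ra Rm; elim/last_ind: gs u => [|gs g IHgs] [x|k] //=.
(* Wires out of range evaluate to the defaults, hence the hypothesis relating these. *)
- by rewrite /list_val /= !nth_nil.
rewrite /list_val !gate_vals_rcons /= !nth_rcons !size_gate_vals.
case: ifP => [_|_]; first exact: (IHgs (Gate I k)).
case: ifP => // _; rewrite /gate_val.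
by case: (op g); [apply: Ra | apply: Rm]; apply: IHgs.
Qed.

(* P relates the value of a node to the value of the node that simulates it;
   a node related to None needs no counterpart.  A source gate is dropped, or
   identified with the counterpart of one of its wires, or copied. *)
Section Simulation.
Variables (I V : Type) (dflt : V) (inp : I -> V) (add mul : V -> V -> V).
Variables (J W : Type) (dflt' : W) (inp' : J -> W) (add' mul' : W -> W -> W).
Variables (P : V -> option W -> Prop) (T : gate_op -> V -> V -> Prop).
Variable S : gate_op -> W -> W -> Prop.

Local Notation val1 := (list_val dflt inp add mul).
Local Notation val2 := (list_val dflt' inp' add' mul').

Hypothesis P_inp : forall x, P (inp x) None \/ exists y, P (inp x) (Some (inp' y)).
Hypothesis P_op : forall o v1 v2 o1 o2, T o v1 v2 -> P v1 o1 -> P v2 o2 ->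
  [\/ P (op_val add mul o v1 v2) None,
      P (op_val add mul o v1 v2) o1,
      P (op_val add mul o v1 v2) o2 |
      exists w1 w2, [/\ o1 = Some w1, o2 = Some w2, S o w1 w2 &
        P (op_val add mul o v1 v2) (Some (op_val add' mul' o w1 w2))]].

Let simulated hs v := P v None \/
  exists2 u, node_below (size hs) u & P v (Some (val2 hs u)).

(** Each source gate appends at most one gate to [hs], which gives the size bound; counterparts
    found earlier keep their values because the list only grows at its end. *)
Lemma simulation_gates gs : topological 0 gs ->
  gates_satisfy dflt inp add mul T gs ->
  exists hs, [/\ topological 0 hs, size hs <= size gs,
    gates_satisfy dflt' inp' add' mul' S hs &
    forall u, node_below (size gs) u -> simulated hs (val1 gs u)].
Proof.
elim/last_ind: gs => [|gs g IHgs].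
  move=> _ _; exists [::]; split=> // [k g|[x|k] //= _]; first by rewrite onth0n.
  case: (P_inp x) => [Px|[y Py]]; [by left | by right; exists (Input y)].
move=> top_g /(gates_satisfy_rcons _ _ _ _ _ top_g)[Tgs Tg].
move: top_g; rewrite topological_rcons add0n => /and3P[top_gs lg rg].
have [hs [top_hs sz_hs Shs sim]] := IHgs top_gs Tgs.
set v := op_val add mul (op g) (val1 gs (left_in g)) (val1 gs (right_in g)).
have old_or_last u : node_below (size (rcons gs g)) u ->
    node_below (size gs) u \/ u = Gate I (size gs).
  rewrite size_rcons; case: u => [x|k] /=; first by left.
  by rewrite ltnS leq_eqVlt => /predU1P[->|]; [right | left].
have keep : simulated hs v -> exists hs, [/\ topological 0 hs,
    size hs <= size (rcons gs g), gates_satisfy dflt' inp' add' mul' S hs &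
    forall u, node_below (size (rcons gs g)) u ->
      simulated hs (val1 (rcons gs g) u)].
  move=> sim_v; exists hs; split=> //; first by rewrite size_rcons leqW.
  move=> u /old_or_last[gs_u | ->]; last by rewrite list_val_last.
  by rewrite list_val_rcons //; apply: sim.
(* The two ways of being simulated are merged into one option value, the form in which [P_op] takes
   its arguments. *)
have node_opt v1 : simulated hs v1 -> exists o1, P v1 o1 /\
    (o1 = None \/ exists2 u, node_below (size hs) u & o1 = Some (val2 hs u)).
  by case=> [Pv|[u hs_u Pv]]; eexists; split; [exact: Pv | left
    | exact: Pv | right; exists u].
have [o1 [P1 def_o1]] := node_opt _ (sim _ lg).
have [o2 [P2 def_o2]] := node_opt _ (sim _ rg).
have sim_o o' : (o' = None \/
    exists2 u, node_below (size hs) u & o' = Some (val2 hs u)) ->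
    P v o' -> simulated hs v.
  by case=> [->|[u hs_u ->]] Pv; [left | right; exists u].
case: (P_op Tg P1 P2) => [Pv|Pv|Pv|[w1 [w2 [o1E o2E Sw Pw]]]].
- by apply: keep; left.
- exact: keep (sim_o _ def_o1 Pv).
- exact: keep (sim_o _ def_o2 Pv).
case: def_o1 def_o2 => [|[u1 hs_u1]]; first by rewrite o1E.
rewrite o1E => -[w1E] [|[u2 hs_u2]]; first by rewrite o2E.
(* The remaining case: both wires have counterparts and the gate is copied onto them. *)
rewrite o2E => -[w2E]; pose h := MkGate (op g) u1 u2.
have top_h : topological 0 (rcons hs h).
  by rewrite topological_rcons add0n top_hs hs_u1.
exists (rcons hs h); split=> //; first by rewrite !size_rcons ltnS.
  by apply/(gates_satisfy_rcons _ _ _ _ _ top_h); rewrite /= -w1E -w2E.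
move=> u /old_or_last[gs_u | ->].
  rewrite list_val_rcons //; case: (sim u gs_u) => [|[u' hs_u' Pu']]; first by left.
  right; exists u'; last by rewrite list_val_rcons.
  by rewrite size_rcons; apply: node_below_leq hs_u'.
rewrite list_val_last -/v; right; exists (Gate J (size hs)).
  by rewrite size_rcons /=.
by rewrite list_val_last /= -w1E -w2E.
Qed.

(** Excluding [None] at the output is what guarantees a node to serve as the new output. *)
Lemma simulation (F : circuit I) :
  gates_satisfy dflt inp add mul T (gates F) ->
  ~ P (value dflt inp add mul F) None ->
  exists F' : circuit J, [/\ circuit_size F' <= circuit_size F,
    gates_satisfy dflt' inp' add' mul' S (gates F') &
    P (value dflt inp add mul F) (Some (value dflt' inp' add' mul' F'))].
Proof.
case: F => gs u gs_u /= TF nP; case/andP: (gs_u) => top_gs lt_u.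
have [hs [top_hs sz Shs sim]] := simulation_gates top_gs TF.
case: (sim u lt_u) => [//|[u' lt_u' Pu']].
have hs_u' : topological 0 hs && node_below (size hs) u' by rewrite top_hs.
by exists (Circuit hs_u').
Qed.

End Simulation.

(** * Invariants of circuits and existence of minimum sizes *)

Lemma gate_invariant (I V : Type) (dflt : V) (inp : I -> V) (add mul : V -> V -> V)
    (T : gate_op -> V -> V -> Prop) (Inv : V -> Prop) (F : circuit I) :
  (forall x, Inv (inp x)) ->
  (forall o v1 v2, T o v1 v2 -> Inv v1 -> Inv v2 ->
    Inv (op_val add mul o v1 v2)) ->
  gates_satisfy dflt inp add mul T (gates F) ->
  Inv (value dflt inp add mul F).
Proof.
(* The induction over gates is borrowed from [simulation], with a relation that ignores the
   counterpart; its conclusion then contradicts the negated goal. *)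
move=> Inv_inp Inv_op TF; apply: NNPP => nInv.
have [x|o v1 v2 o1 o2 Tv Inv1 Inv2|F' [_ _ /nInv]//] := @simulation I V dflt
  inp add mul I V dflt inp add mul (fun v _ => Inv v) T (fun _ _ _ => True)
  _ _ F TF nInv; first by left.
by constructor 1; apply: Inv_op.
Qed.

(** Descent on the size; [P] is an arbitrary proposition, so whether a smaller circuit exists is
    decided classically. *)
Lemma is_min_size_exists I (P : circuit I -> Prop) F :
  P F -> exists m, is_min_size P m.
Proof.
have [k] := ubnP (circuit_size F); elim: k F => // k IHk F; rewrite ltnS => le_F PF.
case: (classic (exists2 G, P G & circuit_size G < circuit_size F)).
  move=> [G PG lt_G]; exact: IHk (leq_trans lt_G le_F) PG.
move=> no_less.
exists (circuit_size F); split; first by exists F.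
by move=> G PG; rewrite leqNgt; apply/negP => lt_G; apply: no_less; exists G.
Qed.

(** * Boolean circuits evaluated in the algebra of Boolean functions *)

Definition fun_or n (g h : bvec n -> bool) : bvec n -> bool := fun a => g a || h a.
Definition fun_and n (g h : bvec n -> bool) : bvec n -> bool := fun a => g a && h a.

Notation fun_val inp :=
  (list_val (fun=> false) (fun x a => inp a x) (@fun_or _) (@fun_and _)).

Definition indep_inputs n (o : gate_op) (g h : bvec n -> bool) : Prop :=
  o = Prod -> independent g h.

(** Evaluation at a point commutes with the pointwise operations. With whole functions as values,
    independence becomes a relation between gate values. *)
Lemma fun_atE n I (inp : bvec n -> I -> bool) (F : circuit I) u :
  fun_at inp F u = fun_val inp (gates F) u.
Proof.
apply: functional_extensionality => a; rewrite /fun_at.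
apply: (@list_val_rel I bool (bvec n -> bool) (fun b g => b = g a)) => //.
- by move=> ? ? ? ? -> ->.
- by move=> ? ? ? ? -> ->.
Qed.

Lemma multilinearE n I (inp : bvec n -> I -> bool) (F : circuit I) :
  multilinear inp F <->
  gates_satisfy (fun=> false) (fun x a => inp a x) (@fun_or n) (@fun_and n)
    (@indep_inputs n) (gates F).
Proof.
by split=> lin k g gk o_g; have := lin k g gk o_g; rewrite !fun_atE.
Qed.

Lemma computesE n I (inp : bvec n -> I -> bool) (F : circuit I) f :
  computes inp F f <-> fun_val inp (gates F) (output F) = f.
Proof.
split=> [F_f | <- a]; last by rewrite fun_atE.
by apply: functional_extensionality => a; rewrite -F_f fun_atE.
Qed.

(** * Produced sets and the monotone functions they define *)

Section ProducedSets.
Variable n : nat.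
Implicit Types (B C : {fset 'X_{1..n}}) (a : bvec n) (b c m : 'X_{1..n}).

Definition exps_mul B C : {fset 'X_{1..n}} :=
  [fset (b + c)%MM | b in B, c in C]%fset.

Local Notation exps_val :=
  (list_val fset0 (fun i : 'I_n => [fset U_(i)%MM])%fset
     (fun B C => B `|` C)%fset exps_mul).

Lemma producedE (F : monotone_circuit n) :
  produced F = exps_val (gates F) (output F).
Proof. by []. Qed.

Lemma exps_mulP B C m :
  reflect (exists b c, [/\ b \in B, c \in C & m = (b + c)%MM]) (m \in exps_mul B C).
Proof.
apply: (iffP (imfset2P _ _ _ _ _)) => [[b Bb [c Cc ->]]|[b [c [Bb Cc ->]]]].
  by exists b, c.
by exists b => //; exists c.
Qed.

Lemma mem_exps_mul B C b c : b \in B -> c \in C -> (b + c)%MM \in exps_mul B C.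
Proof. by move=> Bb Cc; apply/exps_mulP; exists b, c. Qed.

Definition supp_le b a : bool := [forall i, (0 < b i) ==> a i].

Definition up B : bvec n -> bool := fun a => has (supp_le^~ a) B.

Lemma supp_leP b a : reflect (forall i, 0 < b i -> a i) (supp_le b a).
Proof.
by apply: (iffP forallP) => le_ba i; [apply/implyP | apply/implyP/le_ba].
Qed.

Lemma upP B a : reflect (exists2 b, b \in B & forall i, 0 < b i -> a i) (up B a).
Proof.
by apply: (iffP hasP) => -[b Bb /supp_leP le_ba]; exists b.
Qed.

Lemma up_fset1 i : up [fset U_(i)%MM]%fset = fun a => a i.
Proof.
apply: functional_extensionality => a; apply/upP/idP => [[b]|a_i].
  by rewrite inE => /eqP-> /(_ i); apply; rewrite mnm1E eqxx.
exists U_(i)%MM; first by rewrite inE.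
by move=> j; rewrite mnm1E; case: eqP => // <-.
Qed.

Lemma up_fsetU B C : up (B `|` C)%fset = fun_or (up B) (up C).
Proof.
apply: functional_extensionality => a; apply/upP/orP => [[b]|].
  by rewrite inE => /orP[] Bb le_ba; [left | right]; apply/upP; exists b.
by case=> /upP[b Bb le_ba]; exists b; rewrite // inE Bb ?orbT.
Qed.

Lemma up_exps_mul B C : up (exps_mul B C) = fun_and (up B) (up C).
Proof.
apply: functional_extensionality => a; apply/upP/andP => [[m]|].
  move=> /exps_mulP[b [c [Bb Cc ->]]] le_a.
  by split; apply/upP; [exists b | exists c] => // i gt0; apply: le_a;
    rewrite mnmDE addn_gt0 gt0 ?orbT.
move=> [/upP[b Bb le_ba] /upP[c Cc le_ca]]; exists (b + c)%MM.
  exact: mem_exps_mul.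
by move=> i; rewrite mnmDE addn_gt0 => /orP[/le_ba|/le_ca].
Qed.

(** [up] is a homomorphism from sets of exponent vectors, under union and Minkowski sum, to Boolean
    functions. *)
Lemma fun_val_up (gs : seq (gate 'I_n)) u :
  fun_val (@var_input n) gs u = up (exps_val gs u).
Proof.
apply: (@list_val_rel _ _ _ (fun g B => g = up B)) =>
  [|i|g h B C -> ->|g h B C -> ->].
- by apply: functional_extensionality => a; apply/esym/negP=> /upP[].
- by rewrite up_fset1.
- by rewrite up_fsetU.
- by rewrite up_exps_mul.
Qed.

Lemma computes_produced (F : monotone_circuit n) f :
  computes (@var_input n) F f <-> up (produced F) = f.
Proof. by rewrite producedE -fun_val_up; apply: computesE. Qed.

Lemma depends_on_up B i : depends_on (up B) i -> exists2 b, b \in B & 0 < b i.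
Proof.
suff flip a a' : (forall j, (a j != a' j) = (j == i)) -> up B a -> ~~ up B a' ->
    exists2 b, b \in B & 0 < b i.
  move=> [a [a' [aa' /eqP neq]]]; case: (boolP (up B a)) neq => [Ba | nBa].
    by rewrite eq_sym eqb_id => /(flip a a' aa'); apply.
  rewrite eq_sym eqbF_neg negbK => Ba'; apply: (flip a' a) => // j.
  by rewrite eq_sym aa'.
(* If the exponent of [b] at [i] were zero, [b] would also lie below [a'], which differs from [a] at
   [i] only. *)
move=> aa' /upP[b Bb le_ba] /upP nBa'; exists b => //; rewrite lt0n.
apply/negP => /eqP b_i; apply: nBa'; exists b => // j b_j; have := aa' j.
case: (altP (j =P i)) => [jE|_ /negbFE/eqP<-]; last exact: le_ba.
by rewrite jE b_i in b_j.
Qed.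

End ProducedSets.

(** * Supports of the polynomials of arithmetic circuits *)

Section Polynomials.
Import GRing.Theory Num.Theory Order.TTheory.
Local Open Scope ring_scope.
Variable n : nat.

(** Nonnegativity is part of the relation because it is what rules out cancellation at later
    gates. *)
Definition supported_on (p : {mpoly int[n]}) (B : {fset 'X_{1..n}}) : Prop :=
  forall m, 0 <= p@_m /\ (p@_m != 0) = (m \in B).

Lemma circuit_poly_supported (F : monotone_circuit n) :
  supported_on (circuit_poly F) (produced F).
Proof.
apply: (@list_val_rel _ _ _ supported_on) =>
  [m|i m|p q B C pB qC m|p q B C pB qC m].
- by rewrite mcoeff0 eqxx inE.
- by rewrite mcoeffX inE eq_sym; case: eqP.
- have [[p0 pE] [q0 qE]] := (pB m, qC m).
  by rewrite mcoeffD inE paddr_eq0 // negb_and pE qE; split=> //; apply: addr_ge0.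
have ge0 k1 k2 : 0 <= p@_k1 * q@_k2.
  by apply: mulr_ge0; [case: (pB k1) | case: (qC k2)].
rewrite mcoeffM; split; first by apply: sumr_ge0.
rewrite psumr_neq0 //; apply/hasP/exps_mulP => [[[k1 k2] _ /andP[/eqP mE /=]]|].
  move=> /gt_eqF/negbT; rewrite mulf_eq0 negb_or.
  have [_ ->] := pB k1; have [_ ->] := qC k2 => /andP[B1 C2].
  by exists k1, k2.
move=> [b [c [Bb Cc mE]]].
(* [mcoeffM] sums over pairs of vectors of bounded degree; both summands of [m] respect the
   bound. *)
have ltb : (mdeg b < (mdeg m).+1)%N by rewrite mE mdegD ltnS leq_addr.
have ltc : (mdeg c < (mdeg m).+1)%N by rewrite mE mdegD ltnS leq_addl.
exists (BMultinom ltb, BMultinom ltc); first exact: mem_index_enum.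
rewrite /= mE eqxx lt_def ge0 andbT mulf_eq0 negb_or.
by have [_ ->] := pB b; have [_ ->] := qC c; rewrite Bb.
Qed.

Lemma mcoeff_sum_fset (A : {fset 'X_{1..n}}) (c : 'X_{1..n} -> int) m :
  (\sum_(a <- A) c a *: 'X_[a])@_m = if m \in A then c m else 0.
Proof.
rewrite raddf_sum /=; under eq_bigr => a _ do rewrite mcoeffZ mcoeffX.
case: ifP => Am.
  rewrite (big_fsetD1 m) //= eqxx mulr1 big_seq big1 ?addr0 // => a.
  by rewrite !inE => /andP[/negPf-> _]; rewrite mulr0.
rewrite big_seq big1 // => a Aa; case: eqP => [aE|_]; last by rewrite mulr0.
by rewrite -aE Aa in Am.
Qed.

(** A nonzero nonnegative integer is at least 1, so producing [A] arithmetically only constrains the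
    support. *)
Lemma arith_producesE (A : {fset 'X_{1..n}}) (F : monotone_circuit n) :
  arith_produces A F <-> produced F = A.
Proof.
have suppF := circuit_poly_supported F; split=> [[c c_ge1 polyE]|<-].
  apply/fsetP => m; have [_ <-] := suppF m; rewrite polyE mcoeff_sum_fset.
  case: ifP => [/c_ge1 c1|_]; last by rewrite eqxx.
  by rewrite gt_eqF // (lt_le_trans _ c1).
exists (fun m => (circuit_poly F)@_m) => [m|].
  have [ge0 <-] := suppF m; rewrite -gtz0_ge1 lt_def => ->; exact: ge0.
apply/mpolyP => m; rewrite mcoeff_sum_fset; have [_ <-] := suppF m.
by case: eqP.
Qed.

End Polynomials.

(** * Dependence on variables and upward closures *)

Section Dependence.
Variable n : nat.
Implicit Types (g h : bvec n -> bool) (a b c : bvec n).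

Lemma bvleP a b : reflect (forall i, a i -> b i) (bvle a b).
Proof.
by apply: (iffP forallP) => le_ab i; [apply/implyP | apply/implyP/le_ab].
Qed.

Definition dependsb g i : bool := [exists a : bvec n, exists b : bvec n,
  [forall j, (a j != b j) == (j == i)] && (g a != g b)].

Lemma monotone_funW g a b : monotone_fun g -> bvle a b -> g a -> g b.
Proof. by move=> g_mono /g_mono/implyP. Qed.

Lemma depends_onP g i : reflect (depends_on g i) (dependsb g i).
Proof.
apply: (iffP existsP) => [[a /existsP[b /andP[/forallP ab /eqP gab]]]|].
  by exists a, b; split=> // j; rewrite (eqP (ab j)).
move=> [a [b [ab /eqP gab]]]; exists a; apply/existsP; exists b.
by rewrite gab andbT; apply/forallP => j; rewrite ab.
Qed.

(** The positions where [b] and [c] differ are corrected one at a time; none of these changes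
    affects [g]. *)
Lemma eq_on_dependence g b c :
  (forall i, depends_on g i -> b i = c i) -> g b = g c.
Proof.
have [k] := ubnP #|[set i | b i != c i]|; elim: k b => // k IHk b lt_k eq_dep.
case: (set_0Vmem [set i | b i != c i]) => [bc0 | [i]].
  congr (g _); apply/ffunP => i; apply/eqP.
  by move/setP/(_ i): bc0; rewrite !inE => /negbFE.
rewrite inE => bc_i; pose b' : bvec n := [ffun j => if j == i then c j else b j].
have gb : g b = g b'.
  apply: NNPP => neq_g; case/negP: (bc_i); apply/eqP/eq_dep.
  exists b, b'; split=> // j; rewrite ffunE.
  by case: (altP (j =P i)) => [->//|_]; rewrite eqxx.
rewrite gb; apply: IHk => [|j /eq_dep bcj]; last by rewrite ffunE bcj if_same.
rewrite -ltnS (leq_trans _ lt_k) // ltnS; apply: proper_card; apply/properP.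
split; last by exists i; rewrite !inE // ffunE !eqxx.
by apply/subsetP => j; rewrite !inE ffunE; case: (j =P i) => [->|//]; rewrite eqxx.
Qed.

(** The least monotone function above [g]. *)
Definition upclosure g : bvec n -> bool := fun a => [exists b, bvle b a && g b].

Lemma upclosureP g a : reflect (exists2 b, bvle b a & g b) (upclosure g a).
Proof.
apply: (iffP existsP) => [[b /andP[]]|[b le_ba gb]]; exists b => //.
by rewrite le_ba.
Qed.

Lemma upclosure_id g : monotone_fun g -> upclosure g = g.
Proof.
move=> g_mono; apply: functional_extensionality => a.
apply/upclosureP/idP => [[b le_ba gb]|ga]; first exact: monotone_funW gb.
by exists a => //; apply/bvleP.
Qed.

Lemma upclosure_or g h :
  upclosure (fun_or g h) = fun_or (upclosure g) (upclosure h).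
Proof.
apply: functional_extensionality => a.
apply/upclosureP/orP => [[b le_ba /orP[gb|hb]]|].
- by left; apply/upclosureP; exists b.
- by right; apply/upclosureP; exists b.
by case=> /upclosureP[b le_ba b1]; exists b; rewrite // /fun_or b1 ?orbT.
Qed.

Lemma upclosure_and g h : independent g h ->
  upclosure (fun_and g h) = fun_and (upclosure g) (upclosure h).
Proof.
move=> ind; apply: functional_extensionality => a.
apply/upclosureP/andP => [[b le_ba /andP[gb hb]]|].
  by split; apply/upclosureP; exists b.
move=> [/upclosureP[b /bvleP le_ba gb] /upclosureP[c /bvleP le_ca hc]].
(* The two witnesses are glued: [d] agrees with [b] where [g] depends, and with [c] elsewhere, hence
   wherever [h] depends. *)
pose d : bvec n := [ffun i => if dependsb g i then b i else c i].
exists d.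
  apply/bvleP => i; rewrite ffunE.
  by case: ifP => _; [apply: le_ba | apply: le_ca].
apply/andP; split.
  rewrite (eq_on_dependence (c := b)) // => i dep_g; rewrite ffunE.
  by case: depends_onP.
rewrite (eq_on_dependence (c := c)) // => i dep_h; rewrite ffunE.
by case: depends_onP => // dep_g; case: (ind i).
Qed.

Lemma depends_on_upclosure g i : depends_on (upclosure g) i -> depends_on g i.
Proof.
move=> [a [a' [aa' neq]]]; apply: NNPP => ndep; apply: neq.
suff sub c c' : (forall j, (c j != c' j) = (j == i)) ->
    upclosure g c -> upclosure g c'.
  by apply/idP/idP; apply: sub => // j; rewrite eq_sym.
move=> cc' /upclosureP[b /bvleP le_bc gb]; apply/upclosureP.
(* Copying [c'] at position [i] puts [b'] below [c'], and [g] does not notice the change. *)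
pose b' : bvec n := [ffun j => if j == i then c' j else b j].
exists b'.
  apply/bvleP => j; rewrite ffunE; case: (altP (j =P i)) => // neq_ji /le_bc.
  by have := cc' j; rewrite (negPf neq_ji) => /negbFE/eqP->.
rewrite -(eq_on_dependence (b := b)) // => j dep_j; rewrite ffunE.
by case: eqP => // ji; case: ndep; rewrite -ji.
Qed.

Lemma independent_upclosure g h :
  independent g h -> independent (upclosure g) (upclosure h).
Proof.
by move=> ind i [/depends_on_upclosure gi /depends_on_upclosure hi]; case: (ind i).
Qed.

End Dependence.

(** * Minimal ones of monotone functions and multilinear circuits *)

Section LowVectors.
Variable n : nat.
Implicit Types (f g h : bvec n -> bool) (a b c : bvec n) (B C : {fset 'X_{1..n}}).

Lemma LowP g a :
  reflect (g a /\ forall b, bvle b a -> g b -> b = a) (a \in Low g).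
Proof.
rewrite inE; apply: (iffP andP) => -[ga min_a]; split=> //.
  move=> b le_ba gb; apply/eqP; apply: contraTT (gb) => neq_ba.
  by apply: (implyP (forallP min_a b)); rewrite le_ba.
apply/forallP => b; apply/implyP => /andP[le_ba neq_ba].
by apply: contra neq_ba => gb; apply/eqP/min_a.
Qed.

Lemma bvle_trans b a c : bvle a b -> bvle b c -> bvle a c.
Proof. by move=> /bvleP ab /bvleP bc; apply/bvleP => i /ab/bc. Qed.

Lemma bvle_weight a b : bvle a b -> bweight b <= bweight a -> a = b.
Proof.
move=> /bvleP le_ab le_w.
have /eqP/setP eq_ab : [set i | a i] == [set i | b i].
  by rewrite eqEcard le_w andbT; apply/subsetP => i; rewrite !inE; apply: le_ab.
by apply/ffunP => i; have := eq_ab i; rewrite !inE.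
Qed.

(** A one of least weight among those below [a] is minimal. *)
Lemma Low_below g a : g a -> exists2 b, b \in Low g & bvle b a.
Proof.
move=> ga; have Pa : g a && bvle a a by rewrite ga; apply/bvleP.
case: (arg_minnP (P := fun b => g b && bvle b a) (@bweight n) Pa) => b.
move=> /andP[gb le_ba] min_b; exists b => //; apply/LowP; split=> // c le_cb gc.
by apply: bvle_weight => //; apply: min_b; rewrite gc (bvle_trans le_cb).
Qed.

(** Switching off a one of a minimal vector turns the value of [g] to 0. *)
Lemma depends_on_Low g a i : a \in Low g -> a i -> depends_on g i.
Proof.
move=> /LowP[ga min_a] ai.
pose b : bvec n := [ffun j => if j == i then false else a j].
have ab j : (a j != b j) = (j == i).
  by rewrite ffunE; case: (j =P i) => [->|_]; rewrite ?ai ?eqxx.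
exists a, b; split=> //; rewrite ga => /esym gb.
have le_ba : bvle b a by apply/bvleP => j; rewrite ffunE; case: ifP.
by have := ab i; rewrite (min_a b le_ba gb) !eqxx.
Qed.

Lemma mnm_of_bvecE a i : mnm_of_bvec a i = a i :> nat.
Proof. exact: mnmE. Qed.

Lemma LowNP f m :
  reflect (exists2 a, a \in Low f & m = mnm_of_bvec a) (m \in LowN f).
Proof. exact: imfsetP. Qed.

Lemma up_monotone B : monotone_fun (up B).
Proof.
move=> a b /bvleP le_ab; apply/implyP => /upP[c Bc le_ca]; apply/upP.
by exists c => // i /le_ca/le_ab.
Qed.

Lemma up_LowN f : monotone_fun f -> up (LowN f) = f.
Proof.
move=> f_mono; apply: functional_extensionality => a; apply/upP/idP.
  move=> [_ /LowNP[b /LowP[fb _] ->] le_ba].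
  apply: monotone_funW fb => //; apply/bvleP => i b_i; apply: le_ba.
  by rewrite mnm_of_bvecE b_i.
move=> /Low_below[b Lb /bvleP le_ba]; exists (mnm_of_bvec b).
  by apply/LowNP; exists b.
by move=> i; rewrite mnm_of_bvecE lt0b => /le_ba.
Qed.

(** A minimal one of the conjunction is the union of minimal ones [b] and [c] of the factors;
    independence makes their supports disjoint, so the union is also the sum of exponent vectors. *)
Lemma Low_exps_mul B C : independent (up B) (up C) ->
  {in Low (up B), forall b, mnm_of_bvec b \in B} ->
  {in Low (up C), forall c, mnm_of_bvec c \in C} ->
  {in Low (up (exps_mul B C)), forall a, mnm_of_bvec a \in exps_mul B C}.
Proof.
move=> ind LB LC a; rewrite up_exps_mul => /LowP[/andP[Ba Ca] min_a].
have [b Lb /bvleP le_ba] := Low_below Ba.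
have [c Lc /bvleP le_ca] := Low_below Ca.
pose d : bvec n := [ffun i => b i || c i].
have da : d = a.
  apply: min_a; first by apply/bvleP => i; rewrite ffunE => /orP[/le_ba|/le_ca].
  have [/LowP[Bb _] /LowP[Cc _]] := (Lb, Lc).
  by apply/andP; split; [apply: monotone_funW Bb | apply: monotone_funW Cc];
    try exact: up_monotone; apply/bvleP => i; rewrite ffunE => ->; rewrite ?orbT.
suff -> : mnm_of_bvec a = (mnm_of_bvec b + mnm_of_bvec c)%MM.
  by apply: mem_exps_mul; [apply: LB | apply: LC].
apply/mnmP => i; rewrite mnmDE !mnm_of_bvecE -da ffunE.
case b_i: (b i); case c_i: (c i) => //; case: (ind i).
by split; [apply: depends_on_Low Lb b_i | apply: depends_on_Low Lc c_i].
Qed.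

Lemma Low_up_sub B C :
  {in Low (up B), forall b, mnm_of_bvec b \in B} ->
  {in Low (up C), forall c, mnm_of_bvec c \in C} ->
  {in Low (up (B `|` C)%fset), forall a, mnm_of_bvec a \in (B `|` C)%fset}.
Proof.
move=> LB LC a; rewrite up_fsetU in_fsetU => /LowP[/orP BCa min_a]; apply/orP.
case: BCa => [Ba | Ca]; [left; apply: LB | right; apply: LC]; apply/LowP;
  by split=> // b le_ba b1; apply: min_a; rewrite // /fun_or b1 ?orbT.
Qed.

Lemma multilinear_read1 f (F : monotone_circuit n) :
  computes (@var_input n) F f -> multilinear (@var_input n) F -> read1 f F.
Proof.
move=> F_f /multilinearE linF; split=> //.
have upF := (computes_produced _ _).1 F_f.
suff Low_sub : {in Low (up (produced F)), forall a, mnm_of_bvec a \in produced F}.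
  by apply/fsubsetP => _ /LowNP[a La ->]; apply: Low_sub; rewrite upF.
apply: (@gate_invariant _ _ fset0 (fun i => [fset U_(i)%MM])%fset
  (fun B C => B `|` C)%fset (@exps_mul n)
  (fun o B C => indep_inputs o (up B) (up C))
  (fun B => {in Low (up B), forall a, mnm_of_bvec a \in B}) F).
- move=> i a; rewrite up_fset1 in_fset1 => /LowP[ai min_a].
  (* The unit vector is the only minimal one of a variable. *)
  pose b : bvec n := [ffun j => j == i].
  have <- : b = a.
    apply: min_a; last by rewrite ffunE eqxx.
    by apply/bvleP => j; rewrite ffunE => /eqP->.
  by apply/eqP/mnmP => j; rewrite mnm_of_bvecE mnm1E ffunE eq_sym.
- by move=> [] B C indBC LB LC; [apply: Low_up_sub | apply: Low_exps_mul; auto].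
by move=> k g gk; rewrite -!fun_val_up; apply: linF gk.
Qed.

End LowVectors.

(** * Conversions between multilinear and arithmetic circuits *)

Section Conversions.
Variable n : nat.
Implicit Types (f : bvec n -> bool) (A B C : {fset 'X_{1..n}}).

(** Variables become positive literals and every gate is copied. *)
Lemma Lin_of_mLin f (F : monotone_circuit n) :
  computes (@var_input n) F f -> multilinear (@var_input n) F ->
  exists F' : demorgan_circuit n, [/\ circuit_size F' <= circuit_size F,
    computes (@lit_input n) F' f & multilinear (@lit_input n) F'].
Proof.
move=> /computesE F_f /multilinearE linF.
have [|||F' [szF' linF' F'_f]] := @simulation _ _ (fun=> false)
  (fun i a => var_input a i) (@fun_or n) (@fun_and n)
  _ _ (fun=> false) (fun x a => lit_input a x) (@fun_or n) (@fun_and n)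
  (fun v o => o = Some v) (@indep_inputs n) (@indep_inputs n) _ _ F linF.
- move=> i; right; exists (i, true); congr Some.
  by apply: functional_extensionality => a; rewrite /lit_input /= eqb_id.
- by move=> o v1 v2 o1 o2 Tv -> ->; constructor 4; exists v1, v2.
- by [].
exists F'; split=> //; last exact/multilinearE.
by case: F'_f => F'_f; apply/computesE; rewrite -F_f; apply: F'_f.
Qed.

(* Nodes whose upward closure is constantly 1, such as negated variables, are
   related to None: there are no constants to replace them by. *)
Lemma mLin_of_Lin f (F : demorgan_circuit n) :
  non_constant f -> monotone_fun f ->
  computes (@lit_input n) F f -> multilinear (@lit_input n) F ->
  exists F' : monotone_circuit n, [/\ circuit_size F' <= circuit_size F,
    computes (@var_input n) F' f & multilinear (@var_input n) F'].
Proof.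
move=> f_nonconst f_mono /computesE F_f /multilinearE linF.
pose P (g : bvec n -> bool) o :=
  upclosure g = if o is Some w then w else fun=> true.
have [||nPf|F' [szF' linF' F'_f]] := @simulation _ _ (fun=> false)
  (fun x a => lit_input a x) (@fun_or n) (@fun_and n)
  _ _ (fun=> false) (fun i a => var_input a i) (@fun_or n) (@fun_and n)
  P (@indep_inputs n) (@indep_inputs n) _ _ F linF.
- move=> [i []]; [right; exists i | left]; apply: functional_extensionality => a.
    rewrite (@upclosure_id _ (fun a => lit_input a (i, true))).
      by rewrite /lit_input /= eqb_id.
    by move=> b c /bvleP le_bc; rewrite /lit_input /= !eqb_id; apply/implyP/le_bc.
  (* A negated variable holds at the zero vector, which is below every point. *)
  apply/upclosureP; exists [ffun=> false]; last by rewrite /lit_input ffunE.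
  by apply/bvleP => j; rewrite ffunE.
- rewrite /P => -[] g h [w1|] [w2|] /= Tgh g1 h1.
  + constructor 4; exists w1, w2; split=> //; by rewrite upclosure_or g1 h1.
  + constructor 1; rewrite upclosure_or h1.
    by apply: functional_extensionality => a; rewrite /fun_or orbT.
  + by constructor 1; rewrite upclosure_or g1.
  + by constructor 1; rewrite upclosure_or g1.
  + constructor 4; exists w1, w2; split=> //.
      by rewrite -g1 -h1 => _; apply: independent_upclosure; apply: Tgh.
    by rewrite upclosure_and ?g1 ?h1 //; apply: Tgh.
  (* A constant 1 is neutral for conjunction, so the gate is identified with its other wire. *)
  + constructor 2; rewrite upclosure_and ?g1 ?h1; last exact: Tgh.
    by apply: functional_extensionality => a; rewrite /fun_and andbT.
  + by constructor 3; rewrite upclosure_and ?g1 ?h1 //; apply: Tgh.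
  + by constructor 1; rewrite upclosure_and ?g1 ?h1 //; apply: Tgh.
- apply: f_nonconst; exists true => a.
  by rewrite -(upclosure_id f_mono) -F_f (nPf : upclosure (fun_val _ _ _) = _).
exists F'; split=> //; last exact/multilinearE.
apply/computesE; rewrite -(upclosure_id f_mono) -F_f; exact/esym/F'_f.
Qed.

Definition multilin_mnm (m : 'X_{1..n}) : bool := [forall i, m i <= 1].

Lemma multilin_mnmP (m : 'X_{1..n}) : reflect (forall i, m i <= 1) (multilin_mnm m).
Proof. exact: forallP. Qed.

Lemma all_fsetU p B C : all p (B `|` C)%fset = all p B && all p C.
Proof.
apply/allP/andP => [pBC | [/allP pB /allP pC] m].
  by split; apply/allP => m Am; apply: pBC; rewrite inE Am ?orbT.
by rewrite inE => /orP[/pB|/pC].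
Qed.

(** Adding exponents cannot repair one that exceeds 1; nonemptiness supplies a vector to add. *)
Lemma not_multilin_mul B C :
  B != fset0 -> C != fset0 ->
  ~~ (all multilin_mnm B && all multilin_mnm C) ->
  ~~ all multilin_mnm (exps_mul B C).
Proof.
move=> /fset0Pn[b Bb] /fset0Pn[c Cc]; apply: contra => /allP linBC.
by apply/andP; split; apply/allP => m Am; apply/multilin_mnmP => i;
  [have := linBC _ (mem_exps_mul Am Cc) | have := linBC _ (mem_exps_mul Bb Am)];
  move=> /multilin_mnmP/(_ i); rewrite mnmDE; apply: leq_trans;
  rewrite ?leq_addr ?leq_addl.
Qed.

(** A variable shared by both factors would reach exponent 2 in some sum. *)
Lemma independent_multilin B C :
  all multilin_mnm (exps_mul B C) -> independent (up B) (up C).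
Proof.
move=> /allP linBC i [/depends_on_up[b Bb b_i] /depends_on_up[c Cc c_i]].
have /multilin_mnmP/(_ i) := linBC _ (mem_exps_mul Bb Cc).
by rewrite mnmDE leqNgt -addn1 leq_add.
Qed.

Lemma exps_mul_neq0 B C : B != fset0 -> C != fset0 -> exps_mul B C != fset0.
Proof.
move=> /fset0Pn[b Bb] /fset0Pn[c Cc]; apply/fset0Pn.
by exists (b + c)%MM; apply: mem_exps_mul.
Qed.

(* Nodes producing a vector that is not multilinear are related to None: they
   cannot contribute to the output. *)
Lemma mLin_of_Arith f (F : monotone_circuit n) :
  monotone_fun f -> produced F = LowN f ->
  exists F' : monotone_circuit n, [/\ circuit_size F' <= circuit_size F,
    computes (@var_input n) F' f & multilinear (@var_input n) F'].
Proof.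
move=> f_mono F_f.
(* Nonemptiness is kept in the relation because an empty factor would erase a vector that is not
   multilinear. *)
pose P B o := B != fset0 /\ if o is Some w then all multilin_mnm B /\ w = up B
  else ~~ all multilin_mnm B.
have PT B : B != fset0 -> P B None \/ P B (Some (up B)).
  by move=> B0; rewrite /P; case: (all multilin_mnm B); [right | left].
have [||[_ /negP]|F' [szF' linF' [_ [_ F'_f]]]] := @simulation _ _ fset0
  (fun i : 'I_n => [fset U_(i)%MM])%fset (fun B C => B `|` C)%fset (@exps_mul n)
  _ _ (fun=> false) (fun i a => var_input a i) (@fun_or n) (@fun_and n)
  P (fun _ _ _ => True) (@indep_inputs n) _ _ F (fun _ _ _ => I).
- move=> i; have i0 : [fset U_(i)%MM]%fset != fset0 :> {fset 'X_{1..n}}.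
    by apply/fset0Pn; exists U_(i)%MM; rewrite inE.
  case: (PT _ i0) => [|Pi]; [by left | right; exists i].
  by rewrite up_fset1 in Pi.
- move=> [] B C o1 o2 _ [B0 PB] [C0 PC] /=.
    have BC0 : (B `|` C)%fset != fset0 by rewrite fsetU_eq0 negb_and B0.
    case: o1 o2 PB PC => [w1|] [w2|] /=.
    + move=> [linB ->] [linC ->]; constructor 4; exists (up B), (up C).
      by split=> //; rewrite /P BC0 all_fsetU linB linC up_fsetU.
    + by constructor 1; rewrite /P BC0 all_fsetU negb_and PC orbT.
    + by constructor 1; rewrite /P BC0 all_fsetU negb_and PB.
    + by constructor 1; rewrite /P BC0 all_fsetU negb_and PB.
  have BC0 := exps_mul_neq0 B0 C0.
  case: o1 o2 PB PC => [w1|] [w2|] /=.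
  + move=> [linB ->] [linC ->]; case: (PT _ BC0) => [|PBC]; first by constructor 1.
    constructor 4; exists (up B), (up C); split=> //; last by rewrite -up_exps_mul.
    by move=> _; case: PBC => _ [/independent_multilin].
  + move=> _ PC; constructor 1; split=> //.
    by apply: not_multilin_mul => //; rewrite negb_and PC orbT.
  + move=> PB _; constructor 1; split=> //.
    by apply: not_multilin_mul => //; rewrite negb_and PB.
  + move=> PB _; constructor 1; split=> //.
    by apply: not_multilin_mul => //; rewrite negb_and PB.
- rewrite -/(produced F) F_f; apply; apply/allP => _ /LowNP[a _ ->].
  by apply/multilin_mnmP => i; rewrite mnm_of_bvecE leq_b1.
exists F'; split=> //; last exact/multilinearE.
by apply/computesE; rewrite [LHS]F'_f -/(produced F) F_f up_LowN.
Qed.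

End Conversions.

(** * Lower envelopes and read-1 circuits *)

Section Envelope.
Variable n : nat.
Implicit Types (f : bvec n -> bool) (A B C : {fset 'X_{1..n}}) (b c m : 'X_{1..n}).

Lemma mem_Env A m :
  reflect (m \in A /\ {in A, forall b, mdeg m <= mdeg b}) (m \in Env A).
Proof.
rewrite in_fset inE /=; apply: (iffP andP) => -[Am min_m]; split=> //.
  by move=> b Ab; have /forallP/(_ [` Ab]%fset) := min_m.
by apply/forallP => b; apply: min_m; apply: valP.
Qed.

(** [C] is the envelope of the nonempty set [B]; the degree [d] is explicit so that the two wires of
    a sum can be compared. *)
Definition layer (d : nat) B C : Prop :=
  [/\ {in B, forall b, d <= mdeg b}, C != fset0 &
    forall c, (c \in C) = (c \in B) && (mdeg c == d)].

Lemma layer_Env d B C : layer d B C -> C = Env B.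
Proof.
move=> [min_d /fset0Pn[c0]] + CE; rewrite CE => /andP[Bc0 /eqP c0_d].
apply/fsetP => m; rewrite CE; apply/andP/mem_Env => [[Bm /eqP->]//|[Bm min_m]].
by split=> //; rewrite eqn_leq min_d // andbT -c0_d min_m.
Qed.

Lemma layer_fsetU_lt d1 d2 B1 B2 C1 C2 : d1 < d2 ->
  layer d1 B1 C1 -> layer d2 B2 C2 -> layer d1 (B1 `|` B2)%fset C1.
Proof.
move=> lt_d [min1 C1_0 C1E] [min2 _ _]; split=> // [b|c].
  by rewrite inE => /orP[/min1//|/min2]; apply/leq_trans/ltnW.
rewrite C1E inE andb_orl orb_idr // => /andP[/min2 le_d2 /eqP c_d1].
by rewrite c_d1 leqNgt lt_d in le_d2.
Qed.

Lemma layer_fsetU_eq d B1 B2 C1 C2 :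
  layer d B1 C1 -> layer d B2 C2 -> layer d (B1 `|` B2)%fset (C1 `|` C2)%fset.
Proof.
move=> [min1 C1_0 C1E] [min2 _ C2E]; split=> [b||c].
- by rewrite inE => /orP[/min1|/min2].
- by rewrite fsetU_eq0 negb_and C1_0.
- by rewrite !inE C1E C2E andb_orl.
Qed.

(** A sum of vectors attains the bound [d1 + d2] only if both summands attain theirs. *)
Lemma layer_exps_mul d1 d2 B1 B2 C1 C2 :
  layer d1 B1 C1 -> layer d2 B2 C2 ->
  layer (d1 + d2) (exps_mul B1 B2) (exps_mul C1 C2).
Proof.
move=> [min1 C1_0 C1E] [min2 C2_0 C2E]; split=> [b||c].
- by move=> /exps_mulP[b1 [b2 [/min1 ? /min2 ? ->]]]; rewrite mdegD leq_add.
- exact: exps_mul_neq0.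
apply/exps_mulP/andP => [[c1 [c2 []]]|[/exps_mulP[c1 [c2 [B1c1 B2c2 ->]]]]].
  rewrite C1E C2E => /andP[B1c1 /eqP<-] /andP[B2c2 /eqP<-] ->.
  by rewrite mdegD eqxx mem_exps_mul.
have [le1 le2] := (min1 _ B1c1, min2 _ B2c2).
rewrite mdegD => /eqP d_eq; exists c1, c2.
have c1d : mdeg c1 = d1.
  by apply/eqP; rewrite eqn_leq le1 -(leq_add2r d2) -d_eq leq_add2l le2.
move: d_eq; rewrite c1d => /addnI c2d.
by rewrite C1E C2E B1c1 B2c2 c1d c2d !eqxx.
Qed.

Lemma Arith_Env_of_produced (F : monotone_circuit n) :
  exists2 F' : monotone_circuit n, circuit_size F' <= circuit_size F &
    produced F' = Env (produced F).
Proof.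
pose P B o := exists2 C, o = Some C & exists d, layer d B C.
have [||[? //]|F' [szF' _ [_ [<-] [d /layer_Env F'E]]]] := @simulation _ _ fset0
  (fun i : 'I_n => [fset U_(i)%MM])%fset (fun B C => B `|` C)%fset (@exps_mul n)
  _ _ fset0 (fun i : 'I_n => [fset U_(i)%MM])%fset
  (fun B C => B `|` C)%fset (@exps_mul n)
  P (fun _ _ _ => True) (fun _ _ _ => True) _ _ F (fun _ _ _ => I).
- move=> i; right; exists i; exists [fset U_(i)%MM]%fset => //; exists 1; split.
  + by move=> b; rewrite in_fset1 => /eqP->; rewrite mdeg1.
  + by apply/fset0Pn; exists U_(i)%MM; rewrite in_fset1.
  + by move=> c; rewrite in_fset1; case: eqP => // ->; rewrite mdeg1.
- move=> o B1 B2 _ _ _ [C1 -> [d1 L1]] [C2 -> [d2 L2]]; case: o => /=.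
    (* A union keeps only the wire of smaller degree, and the gate disappears; on a tie it is
       copied. *)
    case: (ltngtP d1 d2) => [lt_d|lt_d|eq_d].
    + by constructor 2; exists C1 => //; exists d1; apply: layer_fsetU_lt L2.
    + constructor 3; exists C2 => //; exists d2; rewrite fsetUC.
      exact: layer_fsetU_lt L1.
    + constructor 4; exists C1, C2; split=> //; exists (C1 `|` C2)%fset => //.
      by exists d1; apply: layer_fsetU_eq; rewrite // eq_d.
  constructor 4; exists C1, C2; split=> //; exists (exps_mul C1 C2) => //.
  by exists (d1 + d2); apply: layer_exps_mul.
by exists F'.
Qed.

Lemma lepm_mdeg_eq b m : (b <= m)%MM -> mdeg m <= mdeg b -> m = b.
Proof.
move=> le_bm; rewrite -{1}(submK le_bm) mdegD -[leqRHS]add0n leq_add2r leqn0.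
by rewrite mdeg_eq0 => /eqP bm0; rewrite -(submK le_bm) bm0 add0m.
Qed.

Lemma lepm_mdeg b m : (b <= m)%MM -> mdeg b <= mdeg m.
Proof. by move/submK <-; rewrite mdegD leq_addl. Qed.

(** Every vector of [B] dominates one of [LowN f], and these belong to [B]; hence vectors of least
    degree in [B] are already in [LowN f]. *)
Lemma Env_read1 f B : up B = f -> (LowN f `<=` B)%fset -> Env B = Env (LowN f).
Proof.
move=> upB /fsubsetP LB.
have below b : b \in B -> exists2 a, a \in LowN f & (a <= b)%MM.
  move=> Bb; pose s : bvec n := [ffun i => 0 < b i].
  have fs : f s by rewrite -upB; apply/upP; exists b => // i; rewrite ffunE.
  have [a La /bvleP le_as] := Low_below fs.
  exists (mnm_of_bvec a); first by apply/LowNP; exists a.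
  apply/mnm_lepP => i; rewrite mnm_of_bvecE; have := le_as i; rewrite ffunE.
  by case: (a i) => // ->.
apply/fsetP => m; apply/mem_Env/mem_Env => -[Am min_m].
  have [a La le_am] := below _ Am.
  rewrite (lepm_mdeg_eq le_am (min_m _ (LB _ La))); split=> // b Lb.
  exact: leq_trans (lepm_mdeg le_am) (min_m _ (LB _ Lb)).
split=> [|b /below[a La /lepm_mdeg]]; first exact: LB.
exact/leq_trans/min_m.
Qed.

Lemma mdeg_mnm_of_bvec (a : bvec n) : mdeg (mnm_of_bvec a) = bweight a.
Proof.
rewrite mdegE /bweight -sum1dep_card [RHS]big_mkcond /=; apply: eq_bigr => i _.
by rewrite mnm_of_bvecE; case: (a i).
Qed.

Lemma Env_homogeneous f : homogeneous f -> Env (LowN f) = LowN f.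
Proof.
move=> f_hom; apply/fsetP => m; apply/mem_Env/idP => [[]//|Lm]; split=> //.
move=> _ /LowNP[b Lb ->]; case/LowNP: Lm => a La ->.
by rewrite !mdeg_mnm_of_bvec (f_hom a b).
Qed.

End Envelope.

(** * Existence of circuits producing a given set *)

Section Existence.
Variable n : nat.
Implicit Types (A B C : {fset 'X_{1..n}}) (m : 'X_{1..n}).

Local Notation exps_val :=
  (list_val fset0 (fun i : 'I_n => [fset U_(i)%MM])%fset
     (fun B C => B `|` C)%fset (@exps_mul n)).

(* Quantifying over all circuits to be extended makes it possible to combine
   two circuits without renumbering gates. *)
Definition producible B : Prop := forall gs : seq (gate 'I_n), topological 0 gs ->
  exists hs u, [/\ topological 0 hs, node_below (size hs) u, exps_val hs u = B,
    size gs <= size hs &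
    forall v, node_below (size gs) v -> exps_val hs v = exps_val gs v].

Lemma producible_var i : producible [fset U_(i)%MM]%fset.
Proof. by move=> gs top_gs; exists gs, (Input i). Qed.

Lemma producible_op o B C : producible B -> producible C ->
  producible (op_val (fun B C => B `|` C)%fset (@exps_mul n) o B C).
Proof.
move=> prodB prodC gs top_gs.
have [hs [u [top_hs hs_u <- sz_hs old_hs]]] := prodB gs top_gs.
have [ks [v [top_ks ks_v <- sz_ks old_ks]]] := prodC hs top_hs.
have ks_u := node_below_leq sz_ks hs_u.
exists (rcons ks (MkGate o u v)), (Gate 'I_n (size ks)); split.
- by rewrite topological_rcons add0n top_ks ks_u.
- by rewrite size_rcons /=.
- by rewrite list_val_last /= -(old_ks u).
- by rewrite size_rcons leqW // (leq_trans sz_hs).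
- move=> w gs_w; have hs_w := node_below_leq sz_hs gs_w.
  by rewrite list_val_rcons ?(node_below_leq sz_ks) // old_ks // old_hs.
Qed.

(** One variable is split off at a time. The zero vector is excluded because circuits have no
    constant inputs. *)
Lemma producible_mnm m : m != 0%MM -> producible [fset m]%fset.
Proof.
have [k] := ubnP (mdeg m); elim: k m => // k IHk m; rewrite ltnS => le_k m0.
have [i m_i] : exists i, m i != 0.
  apply/existsP; apply: contraR m0 => /existsPn m0.
  by apply/eqP/mnmP => i; rewrite mnm0E; apply/eqP/negPn/m0.
have mE : (m - U_(i) + U_(i))%MM = m by apply: submK; rewrite lep1mP.
have [mi0|mi0] := eqVneq (m - U_(i))%MM 0%MM.
  by rewrite -mE mi0 add0m; apply: producible_var.
suff -> : [fset m]%fset = exps_mul [fset (m - U_(i))%MM]%fset [fset U_(i)%MM]%fset.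
  apply: (producible_op Prod _ (producible_var i)); apply: IHk => //.
  by rewrite (leq_trans _ le_k) // -{2}mE mdegD mdeg1 addn1.
apply/fsetP => c; rewrite in_fset1; apply/eqP/exps_mulP => [->|].
  by exists (m - U_(i))%MM, U_(i)%MM; rewrite !in_fset1.
by move=> [b [d []]]; rewrite !in_fset1 => /eqP-> /eqP-> ->.
Qed.

Lemma producible_fset A : A != fset0 -> 0%MM \notin A -> producible A.
Proof.
elim/finSet_rect: A => A IHA /fset0Pn[m Am] A0.
have m0 : m != 0%MM by apply: contra A0 => /eqP<-.
have [Am0|Am_neq0] := eqVneq (A `\ m)%fset fset0.
  by rewrite -(fsetD1K Am) Am0 fsetU0; apply: producible_mnm.
rewrite -(fsetD1K Am); apply: (producible_op Sum (producible_mnm m0)).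
apply: IHA => //; first by rewrite fproperD1.
by rewrite in_fsetD1 negb_and A0 orbT.
Qed.

Lemma produced_exists A : A != fset0 -> 0%MM \notin A ->
  exists F : monotone_circuit n, produced F = A.
Proof.
move=> A_neq0 A0.
have [hs [u [top_hs hs_u hsE _ _]]] :=
  producible_fset A_neq0 A0 (isT : topological 0 [::]).
have hs_ok : topological 0 hs && node_below (size hs) u by rewrite top_hs.
by exists (Circuit hs_ok).
Qed.

(** The two constants are the two obstructions to producing [LowN f]: an empty set would force 0,
    and the zero vector would force 1. *)
Lemma LowN_nontrivial (f : bvec n -> bool) :
  non_constant f -> monotone_fun f -> LowN f != fset0 /\ 0%MM \notin LowN f.
Proof.
move=> f_nonconst f_mono; split.
  apply/negP => /eqP L0; apply: f_nonconst; exists false => a.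
  by rewrite -(up_LowN f_mono) L0; apply/negP => /upP[].
apply/negP => L0; apply: f_nonconst; exists true => a.
rewrite -(up_LowN f_mono); apply/upP; exists 0%MM => // i.
by rewrite mnm0E.
Qed.

End Existence.

(** * Assembly of the inequalities between the five minimum sizes *)

Theorem theorem4 (n : nat) (f : {ffun 'I_n -> bool} -> bool)
    (f_nonconst : non_constant f) (f_mono : monotone_fun f) :
  exists arith_env read lin mlin arith : nat,
    [/\ is_Arith (Env (LowN f)) arith_env, is_Read1 f read, is_Lin f lin,
        is_mLin f mlin & is_Arith (LowN f) arith] /\
    [/\ arith_env <= read, read <= lin, lin = mlin & mlin <= arith] /\
    (homogeneous f -> [/\ arith = read, read = lin & lin = mlin]).
Proof.
have Lin_Arith (F : monotone_circuit n) : arith_produces (LowN f) F -> _ :=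
  fun FL => mLin_of_Arith f_mono ((arith_producesE _ _).1 FL).
have Env_Read (F : monotone_circuit n) : read1 f F ->
    exists2 F', arith_produces (Env (LowN f)) F' & circuit_size F' <= circuit_size F.
  move=> [/computes_produced upF LF].
  have [F' szF' F'E] := Arith_Env_of_produced F; exists F' => //.
  by apply/arith_producesE; rewrite F'E (Env_read1 upF LF).
have [L_neq0 L0] := LowN_nontrivial f_nonconst f_mono.
(* All five minima exist: a circuit for [LowN f] is converted successively into one of each other
   kind. *)
have [F0 /arith_producesE F0_f] := produced_exists L_neq0 L0.
have [F1 [_ F1_f linF1]] := Lin_Arith _ F0_f.
have [F2 [_ F2_f linF2]] := Lin_of_mLin F1_f linF1.
have read1F1 := multilinear_read1 F1_f linF1.
have [F3 F3_f _] := Env_Read _ read1F1.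
have [arith_env min_env] := is_min_size_exists F3_f.
have [read min_read] := is_min_size_exists read1F1.
have [lin min_lin] := is_min_size_exists
  (conj F2_f linF2 : (fun F => computes _ F f /\ multilinear _ F) F2).
have [mlin min_mlin] := is_min_size_exists
  (conj F1_f linF1 : (fun F => computes _ F f /\ multilinear _ F) F1).
have [arith min_arith] := is_min_size_exists F0_f.
have le_env_read : arith_env <= read.
  case: min_read => [[F /Env_Read[F' F'_f szF'] <-] _].
  exact: leq_trans (min_env.2 _ F'_f) szF'.
have le_mlin_lin : mlin <= lin.
  case: min_lin => [[F [F_f linF] <-] _].
  have [F' [szF' F'_f linF']] := mLin_of_Lin f_nonconst f_mono F_f linF.
  exact: leq_trans (min_mlin.2 _ (conj F'_f linF')) szF'.
have [le_lin_mlin le_read_mlin] : lin <= mlin /\ read <= mlin.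
  case: min_mlin => [[F [F_f linF] <-] _].
  have [F' [szF' F'_f linF']] := Lin_of_mLin F_f linF; split.
    exact: leq_trans (min_lin.2 _ (conj F'_f linF')) szF'.
  exact: min_read.2 _ (multilinear_read1 F_f linF).
have le_mlin_arith : mlin <= arith.
  case: min_arith => [[F /Lin_Arith[F' [szF' F'_f linF']] <-] _].
  exact: leq_trans (min_mlin.2 _ (conj F'_f linF')) szF'.
have eq_lin : lin = mlin by apply/eqP; rewrite eqn_leq le_lin_mlin.
exists arith_env, read, lin, mlin, arith; do 2!split=> //; first by rewrite eq_lin.
(* Homogeneity gives [Env (LowN f) = LowN f], hence [arith <= arith_env], which closes the chain
   into a cycle. *)
move=> f_hom; have eq_arith : arith = read.
  apply/eqP; rewrite eqn_leq (leq_trans le_read_mlin) // andbT.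
  apply: leq_trans le_env_read; case: min_env => [[F F_f <-] _].
  by apply: min_arith.2; rewrite -(Env_homogeneous f_hom).
split=> //; apply/eqP; rewrite eqn_leq eq_lin le_read_mlin.
by rewrite -eq_arith.
Qed.
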